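(* Let $G$ be a finite group and $\mathcal{S}$ a 2-dimensional simplicial complex whose vertices are elements of $G$, such that $\mathcal{C}=Sc[\mathcal{S},G]$ is a commutative triplet structure. Then \[\lambda(G_{walk}(\mathcal{C}))\le\sqrt{\tfrac12+\tfrac12\,\lambda\big(G_{dual}\,ⓩ\, L\big)}.\]
   Context: For a 2-complex $X$: $X(1)$ is the set of 2-sets contained in a triangle, $X(2)$ the set of triangles; $X$ is $\tilde d$-regular if every edge of $X(1)$ is in exactly $\tilde d$ triangles. $G_{walk}(X)$ is the graph on $X(1)$ where two distinct edges are adjacent iff they lie in a common triangle. $\lambda(\cdot)$ is the maximal non-trivial eigenvalue of the normalized adjacency operator. For $\sigma\subseteq G$, $g\in G$, put $\sigma\cdot g=\{sg:s\in\sigma\}$. $Sc[\mathcal{S},G]=\{\sigma\cdot g:\sigma\in\mathcal{S},g\in G\}$ (a complex on $G$). Let $\mathcal{T}=\mathcal{S}(1)$ and $\mathcal{T}_o$ the set of ordered pairs $(t_1,t_2)$ with $\{t_1,t_2\}\in\mathcal{T}$. $\mathcal{C}$ is a commutative triplet structure (CTS) if: (0) $\{s,s^{-1}\}\notin\mathcal{S}(1)$ for every vertex $s$ of $\mathcal{S}$; (A) $\mathcal{S}$ is $\tilde d$-regular for some $\tilde d$; (B) $ab=ba$ for all $\{a,b\}\in\mathcal{T}$; (C) $\{a,b\}\in\mathcal{T}\iff\{a^{-1},b^{-1}\}\in\mathcal{T}$; (D) for $t\neq t'\in\mathcal{T}_o$, $t_1t_2^{-1}=t'_1(t'_2)^{-1}$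 implies $t'_2=t_1^{-1}$ and $t'_1=t_2^{-1}$; (E) the 1-skeleton of $\mathcal{S}$ (vertices of $\mathcal{S}$, edges $\mathcal{T}$) is connected. For $\tau=\{a,b\}\in\mathcal{T}$ write $\hat\tau g=abg$ and $\tau^{-1}=\{a^{-1},b^{-1}\}$. $L=G_{walk}(\mathcal{S})$. $G_{dual}$ is the graph on $G$ with edges $\{g,\hat\tau g\}$ for $g\in G,\tau\in\mathcal{T}$. The replacement product on $G\times\mathcal{T}$ has red edges $(g,\tau)\sim(g,\tau')$ for $\tau\sim\tau'$ in $L$, and blue edges $(g,\tau)\sim(\hat\tau g,\tau^{-1})$; $P_R,P_B$ are the normalized adjacency matrices of red and blue edges. The zig-zag product $G_{dual}ⓩL$ is the graph on $G\times\mathcal{T}$ with normalized adjacency operator $P_RP_BP_R$. *)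

(* Defs.v *)
From HB Require Import structures.
From mathcomp Require Import all_boot all_order all_algebra all_fingroup.
From mathcomp Require Import reals.
Set Implicit Arguments. Unset Strict Implicit. Unset Printing Implicit Defensive.
Import Order.TTheory GRing.Theory Num.Theory.
Local Open Scope ring_scope.

Section Spectral.
Variable R : realType.

Definition nadj (V : finType) (adj : rel V) : V -> V -> R :=
  fun x y => (adj x y)%:R / (#|[set z | adj x z]|)%:R.

Definition kmul (V : finType) (P Q : V -> V -> R) : V -> V -> R :=
  fun x z => \sum_y P x y * Q y z.

Definition nontrivial_eigenvalue (V : finType) (P : V -> V -> R) (mu : R) : Prop :=
  exists f : V -> R, (exists x y, f x != f y) /\
    forall x, \sum_y P x y * f y = mu * f x.

Definition is_lambda (V : finType) (P : V -> V -> R) (l : R) : Prop :=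
  nontrivial_eigenvalue P l /\
  forall mu, nontrivial_eigenvalue P mu -> mu <= l.
End Spectral.

Section Complexes.
Variable gT : finGroupType.
Local Open Scope group_scope.

(* a 2-complex is given by its set of triangles X(2) *)
Definition edges1 (X : {set {set gT}}) : {set {set gT}} :=
  [set e : {set gT} | (#|e| == 2)%N && [exists t in X, e \subset t]].

Definition vertices (X : {set {set gT}}) : {set gT} := \bigcup_(t in X) t.

Definition Edge (X : {set {set gT}}) := {e : {set gT} | e \in edges1 X}.

Definition walk_adj (X : {set {set gT}}) : rel (Edge X) :=
  fun e e' => (val e != val e') &&
    [exists t in X, (val e \subset t) && (val e' \subset t)].

Definition Gwalk_op (R : realType) (X : {set {set gT}}) : Edge X -> Edge X -> R :=
  nadj R (@walk_adj X).

Definition Sc (S : {set {set gT}}) : {set {set gT}} :=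
  [set (sigma :* g) | sigma in S, g in [set: gT]].

Definition CTS (S : {set {set gT}}) : Prop :=
  let T := edges1 S in
  (forall s, s \in vertices S -> [set s; s^-1] \notin T) /\
  (exists d : nat, forall e, e \in T -> #|[set t in S | e \subset t]| = d) /\
  (forall a b, [set a; b] \in T -> a * b = b * a) /\
  (forall a b, ([set a; b] \in T) = ([set a^-1; b^-1] \in T)) /\
  (forall t1 t2 u1 u2, [set t1; t2] \in T -> [set u1; u2] \in T ->
      (t1, t2) != (u1, u2) -> t1 * t2^-1 = u1 * u2^-1 ->
      u2 = t1^-1 /\ u1 = t2^-1) /\
  (forall a b, a \in vertices S -> b \in vertices S ->
      connect [rel x y | [set x; y] \in T] a b).

Definition hat (tau : {set gT}) (g : gT) : gT := (\prod_(x in tau) x) * g.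
Definition inv_set (tau : {set gT}) : {set gT} := [set x^-1 | x in tau].

Definition red_adj (S : {set {set gT}}) : rel (gT * Edge S) :=
  fun x y => (x.1 == y.1) && walk_adj x.2 y.2.

Definition blue_step (S : {set {set gT}}) (x y : gT * Edge S) : bool :=
  (val y.2 == inv_set (val x.2)) && (y.1 == hat (val x.2) x.1).

Definition blue_adj (S : {set {set gT}}) : rel (gT * Edge S) :=
  fun x y => blue_step x y || blue_step y x.

Definition zigzag_op (R : realType) (S : {set {set gT}}) : gT * Edge S -> gT * Edge S -> R :=
  kmul (kmul (nadj R (@red_adj S)) (nadj R (@blue_adj S))) (nadj R (@red_adj S)).
End Complexes.
Arguments Gwalk_op {gT} R X.
Arguments zigzag_op {gT} R S.

(* Main.v *)
Require Import Defs.
From HB Require Import structures.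
From mathcomp Require Import all_boot all_order all_algebra all_fingroup.
From mathcomp Require Import reals complex sesquilinear spectral ring lra.
Set Implicit Arguments. Unset Strict Implicit. Unset Printing Implicit Defensive.
Import Order.TTheory GRing.Theory Num.Theory.
Local Open Scope ring_scope.

(** By commutativity and condition (D), the map [(g, tau) |-> tau g] onto the
edges of the Cayley complex is two-to-one and its fibres are exactly the blue
edges. The links of the two points [x], [B x] of a fibre embed disjointly and
exhaust the neighbours of the image edge, so an eigenfunction [f] of the walk
lifts to [F] with [mu F = (K + K \o B) / 2], where [K := P_R F]. Hence
[mu^2 |F|^2 = |K|^2 / 2 + <F, P_R P_B P_R F> / 2]. After subtracting the mean
of [F], the first term is at most [|F|^2 / 2] and the second at most
[lambda |F|^2 / 2], by the spectral theorem for [P_R P_B P_R]. *)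

(** * Spectral bound for real symmetric kernels *)

Lemma complex_Re_sum (R : rcfType) (I : finType) (E : I -> R[i]) :
  complex.Re (\sum_i E i) = \sum_i complex.Re (E i).
Proof. by apply: (big_morph (@complex.Re R)) => // -[a b] [c d]. Qed.

Lemma complex_Im_sum (R : rcfType) (I : finType) (E : I -> R[i]) :
  complex.Im (\sum_i E i) = \sum_i complex.Im (E i).
Proof. by apply: (big_morph (@complex.Im R)) => // -[a b] [c d]. Qed.

Lemma complex_ReMr (R : rcfType) (z : R[i]) (k : R) :
  complex.Re (z * (real_complex R k)) = k * complex.Re z.
Proof. by case: z => a b /=; rewrite mulr0 subr0 mulrC. Qed.

Lemma complex_ImMr (R : rcfType) (z : R[i]) (k : R) :
  complex.Im (z * (real_complex R k)) = k * complex.Im z.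
Proof. by case: z => a b /=; rewrite mulr0 add0r mulrC. Qed.

Local Open Scope sesquilinear_scope.

(** Since [Z] and [k] are real, the real and imaginary parts of [v] satisfy the eigenvalue equation
    separately; if either is non-constant, [k] is a non-trivial eigenvalue. *)
Lemma complex_eigenvector_const (R : realType) (V : finType) (Z : V -> V -> R)
    (l k : R) (v : V -> R[i]) :
  (forall mu, nontrivial_eigenvalue Z mu -> mu <= l) ->
  (forall x, \sum_y v y * real_complex R (Z x y) = v x * real_complex R k) ->
  k <= l \/ forall x y, v x = v y.
Proof.
move=> ub ev.
have evRe x : \sum_y Z x y * complex.Re (v y) = k * complex.Re (v x).
  rewrite -complex_ReMr -ev complex_Re_sum.
  by apply: eq_bigr => y _; rewrite complex_ReMr.
have evIm x : \sum_y Z x y * complex.Im (v y) = k * complex.Im (v x).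
  rewrite -complex_ImMr -ev complex_Im_sum.
  by apply: eq_bigr => y _; rewrite complex_ImMr.
have case_const (g : V -> R) : (forall x, \sum_y Z x y * g y = k * g x) ->
    k <= l \/ forall x y, g x = g y.
  move=> evg; case: (boolP [forall x, forall y, g x == g y]) => [/forallP h|].
    by right=> x y; apply/eqP/(forallP (h x)).
  move=> /forallPn[x /forallPn[y gxy]]; left; apply: ub; exists g.
  by split=> //; exists x, y.
case: (case_const _ evRe) => [|cRe]; first by left.
case: (case_const _ evIm) => [|cIm]; first by left.
right=> x y; move: (cRe x y) (cIm x y).
by case: (v x) => a b; case: (v y) => c d /= -> ->.
Qed.

(** In an orthonormal eigenbasis, any eigenvector with eigenvalue above [l] is constant, hence
    orthogonal to the mean-zero [F], and contributes nothing. *)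
Lemma rayleigh_le_nontrivial_eigenvalue (R : realType) (V : finType)
    (Z : V -> V -> R) (l : R) (F : V -> R) :
  (forall x y, Z x y = Z y x) ->
  (forall mu, nontrivial_eigenvalue Z mu -> mu <= l) ->
  \sum_x F x = 0 ->
  \sum_x F x * (\sum_y Z x y * F y) <= l * \sum_x F x ^+ 2.
Proof.
move=> symZ ub F0.
pose n := #|V|.
pose e (i : 'I_n) : V := enum_val i.
pose toC : {rmorphism R -> R[i]} := real_complex R.
pose A : 'M[R[i]]_n := \matrix_(i, j) toC (Z (e i) (e j)).
pose u : 'rV[R[i]]_n := \row_i toC (F (e i)).
have toC_real (k : R) : toC k \is Num.real by apply/complex_realP; exists k.
have Aherm : A \is hermsymmx.
  apply: realsym_hermsym.
    apply/is_hermitianmxP; rewrite expr0 scale1r.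
    by apply/matrixP => i j; rewrite !mxE symZ.
  by apply/mxOverP => i j; rewrite mxE.
have /orthomx_spectralP Aeq := hermitian_normalmx Aherm.
have /mxOverP Dreal := hermitian_spectral_diag_real Aherm.
set U := spectralmx A in Aeq *; set D := spectral_diag A in Aeq Dreal *.
have Uu : U \is unitarymx := spectral_unitarymx A.
(* The rows of [U] are orthonormal eigenvectors, and [w] below holds the coordinates of [u] along
   them. *)
have UA : U *m A = diag_mx D *m U.
  by rewrite Aeq !mulmxA mulmxV ?mul1mx // unitarymx_unit.
rewrite (invmx_unitary Uu) in Aeq.
pose w := u *m U ^t*.
have wE : u *m A *m u ^t* = w *m diag_mx D *m w ^t*.
  by rewrite Aeq /w !trmx_mul !map_mxM trmxCK !mulmxA.
have wwE : u *m u ^t* = w *m w ^t*.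
  by rewrite /w !trmx_mul !map_mxM trmxCK mulmxA mulmxKtV.
have uAE : (u *m A *m u ^t*) 0 0 = toC (\sum_x F x * (\sum_y Z x y * F y)).
  rewrite mxE rmorph_sum /= (reindex e) /=; last exact/onW_bij/enum_val_bij.
  apply: eq_bigr => i _; rewrite rmorphM mulrC rmorph_sum /= !mxE.
  rewrite (CrealP (toC_real _)) [in RHS](reindex e) /=; last exact/onW_bij/enum_val_bij.
  congr (_ * _); apply: eq_bigr => j _.
  by rewrite !mxE rmorphM mulrC symZ.
have uuE : (u *m u ^t*) 0 0 = toC (\sum_x F x ^+ 2).
  rewrite mxE rmorph_sum /= (reindex e) /=; last exact/onW_bij/enum_val_bij.
  by apply: eq_bigr => i _; rewrite !mxE (CrealP (toC_real _)) -rmorphM expr2.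
suff: toC (\sum_x F x * (\sum_y Z x y * F y)) <= toC (l * \sum_x F x ^+ 2).
  by rewrite lecR.
(* Both sides become sums over eigenvectors with weights [|w_i|^2], compared term by term. *)
rewrite rmorphM /= -uAE -uuE wE wwE !mxE mulr_sumr; apply: ler_sum => i _.
rewrite mul_mx_diag !mxE mulrAC mulrC -normCK.
have /complex_realP[k Dk] := Dreal 0 i.
have evU x : \sum_y U i (enum_rank y) * toC (Z x y) = U i (enum_rank x) * toC k.
  move/matrixP/(_ i (enum_rank x)): UA; rewrite mul_diag_mx !mxE Dk mulrC => <-.
  rewrite (reindex e) /=; last exact/onW_bij/enum_val_bij.
  by apply: eq_bigr => j _; rewrite mxE /e enum_valK enum_rankK symZ.
have [kl|Uconst] := complex_eigenvector_const ub evU.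
  by rewrite Dk ler_wpM2r ?exprn_ge0 // lecR.
(* When row [i] of [U] is constant, the coordinate of [u] along it is a multiple of the sum of [F],
   which is zero. *)
suff -> : \sum_j u 0 j * (U ^t*) j i = 0 by rewrite normr0 expr0n !mulr0.
transitivity (\sum_j u 0 j * (U i i)^*).
  apply: eq_bigr => j _; rewrite !mxE -[in U i j](enum_valK j).
  by rewrite (Uconst _ (e i)) /e enum_valK.
rewrite -mulr_suml; have -> : \sum_j u 0 j = toC (\sum_x F x).
  rewrite rmorph_sum /= (reindex e) /=; last exact/onW_bij/enum_val_bij.
  by apply: eq_bigr => j _; rewrite mxE.
by rewrite F0 rmorph0 mul0r.
Qed.

(** * Stochastic kernels and involutions *)

Lemma kmul_apply (R : realType) (V : finType) (P Q : V -> V -> R) (F : V -> R) x :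
  \sum_y kmul P Q x y * F y = \sum_y P x y * \sum_z Q y z * F z.
Proof.
under eq_bigr do rewrite mulr_suml.
rewrite exchange_big; apply: eq_bigr => y _; rewrite mulr_sumr.
by apply: eq_bigr => z _; rewrite mulrA.
Qed.

Lemma kmul_sym3 (R : realType) (V : finType) (P Q : V -> V -> R) :
  (forall x y, P x y = P y x) -> (forall x y, Q x y = Q y x) ->
  forall x y, kmul (kmul P Q) P x y = kmul (kmul P Q) P y x.
Proof.
move=> sP sQ x y; rewrite /kmul.
under eq_bigr do rewrite mulr_suml.
under [RHS]eq_bigr do rewrite mulr_suml.
rewrite exchange_big; apply: eq_bigr => a _; apply: eq_bigr => b _.
by rewrite (sP x) (sQ a) (sP b); ring.
Qed.

Lemma kernel_adjoint (R : realType) (V : finType) (P : V -> V -> R) (F H : V -> R) :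
  (forall x y, P x y = P y x) ->
  \sum_x F x * (\sum_y P x y * H y) = \sum_x (\sum_y P x y * F y) * H x.
Proof.
move=> sP; under eq_bigr do rewrite mulr_sumr.
under [RHS]eq_bigr do rewrite mulr_suml.
rewrite exchange_big; apply: eq_bigr => a _; apply: eq_bigr => b _.
by rewrite mulrCA mulrA (sP b).
Qed.

Section StochasticKernel.
Variables (R : realType) (V : finType) (P : V -> V -> R).
Hypothesis P_sym : forall x y, P x y = P y x.
Hypothesis P_ge0 : forall x y, 0 <= P x y.
Hypothesis P_sum1 : forall x, \sum_y P x y = 1.

Lemma stochastic_sum (F : V -> R) : \sum_x \sum_y P x y * F y = \sum_x F x.
Proof.
rewrite exchange_big; apply: eq_bigr => y _; rewrite -mulr_suml.
by under eq_bigr do rewrite P_sym; rewrite P_sum1 mul1r.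
Qed.

(** The difference of the two sides is the variance of [F] under the probability weights [P x]. *)
Lemma stochastic_sqr_le (F : V -> R) x :
  (\sum_y P x y * F y) ^+ 2 <= \sum_y P x y * F y ^+ 2.
Proof.
set m := \sum_y P x y * F y.
rewrite -subr_ge0; have -> : \sum_y P x y * F y ^+ 2 - m ^+ 2 =
    \sum_y P x y * (F y - m) ^+ 2.
  have -> : \sum_y P x y * (F y - m) ^+ 2 =
      \sum_y (P x y * F y ^+ 2 - (2 * m) * (P x y * F y) + m ^+ 2 * P x y).
    by apply: eq_bigr => y _; ring.
  rewrite big_split sumrB -!mulr_sumr P_sum1 -/m /=; ring.
by apply: sumr_ge0 => y _; rewrite mulr_ge0 ?P_ge0 ?sqr_ge0.
Qed.

Lemma stochastic_contraction (F : V -> R) :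
  \sum_x (\sum_y P x y * F y) ^+ 2 <= \sum_x F x ^+ 2.
Proof.
by rewrite -[leRHS]stochastic_sum; apply: ler_sum => x _; apply: stochastic_sqr_le.
Qed.

Variable B : V -> V.
Hypothesis BK : involutive B.
Variable Q : V -> V -> R.
Hypothesis QE : forall x y, Q x y = (y == B x)%:R.

Lemma involution_kernel_apply (F : V -> R) x : \sum_y Q x y * F y = F (B x).
Proof.
rewrite (bigD1 (B x)) //= QE eqxx mul1r big1 ?addr0 // => y /negPf yBx.
by rewrite QE yBx mul0r.
Qed.

(** In the application [P] is the red kernel, [B] the blue involution and [F] the lift of an
    eigenfunction of the walk. *)
Lemma folded_eigenvalue_sqr_le (l mu : R) (F : V -> R) :
  (forall nu, nontrivial_eigenvalue (kmul (kmul P Q) P) nu -> nu <= l) ->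
  (exists x y, F x != F y) ->
  (forall x, mu * F x = 2^-1 * (\sum_y P x y * F y + \sum_y P (B x) y * F y)) ->
  mu ^+ 2 <= 2^-1 + 2^-1 * l.
Proof.
move=> ub [x0 [y0 Fxy]] evF.
have sumB (H : V -> R) : \sum_x H (B x) = \sum_x H x.
  by rewrite [RHS](reindex_inj (inv_inj BK)).
pose m := (\sum_x F x) / #|V|%:R.
have V_gt0 : (0 : R) < #|V|%:R by rewrite ltr0n; apply/card_gt0P; exists x0.
(* Summing [evF] over all points shows that the constant [m] satisfies the same equation, so it may
   be subtracted from [F]. *)
have mean_fixed : mu * m = m.
  rewrite /m mulrA; congr (_ / _); rewrite mulr_sumr.
  under eq_bigr do rewrite evF.
  rewrite -mulr_sumr big_split /= (sumB (fun x => \sum_y P x y * F y)).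
  rewrite stochastic_sum; lra.
pose H x := F x - m.
have PH x : \sum_y P x y * H y = \sum_y P x y * F y - m.
  under eq_bigr do rewrite mulrBr.
  by rewrite sumrB -mulr_suml P_sum1 mul1r.
pose K x := \sum_y P x y * H y.
have evH x : mu * H x = 2^-1 * (K x + K (B x)).
  rewrite /K !PH /H mulrBr evF mean_fixed; lra.
have H0 : \sum_x H x = 0.
  rewrite sumrB sumr_const -mulr_natr /m mulfVK ?subrr //.
  by rewrite gt_eqF.
have H_gt0 : 0 < \sum_x H x ^+ 2.
  rewrite lt_def sumr_ge0 ?andbT; last by move=> *; rewrite sqr_ge0.
  apply: contra Fxy => /eqP/psumr_eq0P h.
  have {}h x : F x = m.
    apply/eqP; rewrite -subr_eq0 -sqrf_eq0; apply/eqP/h => // *.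
    exact: sqr_ge0.
  by rewrite !h.
have Q_sym x y : Q x y = Q y x.
  by rewrite !QE; congr (nat_of_bool _)%:R; rewrite -(inv_eq BK) eq_sym.
(* The outer factor [P] is self-adjoint and moves onto the left [H]; the inner [Q] composes with
   [B]. *)
have crossE : \sum_x K x * K (B x) =
    \sum_x H x * (\sum_y kmul (kmul P Q) P x y * H y).
  under [RHS]eq_bigr do rewrite kmul_apply kmul_apply.
  rewrite [RHS]kernel_adjoint //; apply: eq_bigr => x _.
  by rewrite involution_kernel_apply.
have cross_le : \sum_x K x * K (B x) <= l * \sum_x H x ^+ 2.
  rewrite crossE; apply: rayleigh_le_nontrivial_eigenvalue => //.
  exact: kmul_sym3.
have sqr_le := stochastic_contraction H.
rewrite -(ler_pM2r H_gt0) mulr_sumr.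
(* Squaring [evH] gives two squares and a cross term; the squares have equal sums because [B] is a
   bijection. *)
have -> : \sum_x mu ^+ 2 * H x ^+ 2 =
    2^-1 * (\sum_x K x ^+ 2) + 2^-1 * \sum_x K x * K (B x).
  transitivity (\sum_x (4^-1 * K x ^+ 2 + 4^-1 * K (B x) ^+ 2 + 2^-1 * (K x * K (B x)))).
    by apply: eq_bigr => x _; rewrite -exprMn evH; field.
  rewrite !big_split /= -!mulr_sumr (sumB (fun x => K x ^+ 2)); lra.
rewrite -/K in sqr_le; nra.
Qed.
End StochasticKernel.

(** * Walks on edges of a 2-complex *)

Section NormalizedAdjacency.
Variables (R : realType) (V : finType) (adj : rel V).

Lemma nadj_apply (f : V -> R) x :
  \sum_y nadj R adj x y * f y =
  (#|[set z | adj x z]|%:R)^-1 * \sum_(y in [set z | adj x z]) f y.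
Proof.
rewrite mulr_sumr [RHS]big_mkcond; apply: eq_bigr => y _.
rewrite /nadj inE; case: (adj x y); first by rewrite mul1r.
by rewrite !mul0r.
Qed.

Lemma nadj_ge0 x y : 0 <= nadj R adj x y.
Proof. by rewrite /nadj divr_ge0 ?ler0n. Qed.

Lemma nadj_sum1 x : (0 < #|[set z | adj x z]|)%N -> \sum_y nadj R adj x y = 1.
Proof.
move=> deg_gt0; have := nadj_apply (fun=> 1) x.
under eq_bigr do rewrite mulr1.
by rewrite sumr_const mulVf // pnatr_eq0 -lt0n.
Qed.

Lemma nadj_sym n : symmetric adj -> (forall x, #|[set z | adj x z]| = n) ->
  forall x y, nadj R adj x y = nadj R adj y x.
Proof. by move=> sym reg x y; rewrite /nadj !reg sym. Qed.
End NormalizedAdjacency.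

Section Walk.
Variable gT : finGroupType.
Local Open Scope group_scope.
Implicit Types (X : {set {set gT}}) (e t : {set gT}).

Definition mkEdge X e (eX : e \in edges1 X) : Edge X :=
  exist (fun e => e \in edges1 X) e eX.

Lemma edges1P X e :
  reflect (#|e| = 2%N /\ exists2 t, t \in X & e \subset t) (e \in edges1 X).
Proof.
rewrite inE; apply: (iffP andP) => -[/eqP ce h]; split => //; last first.
  by apply/existsP; case: h => t tX et; exists t; rewrite tX.
by case/existsP: h => t /andP[tX et]; exists t.
Qed.

Lemma walk_adjP X (e e' : Edge X) :
  reflect (val e != val e' /\ exists t, [/\ t \in X, val e \subset t & val e' \subset t])
    (walk_adj e e').
Proof.
apply: (iffP andP) => -[ee' h]; split => //.
  by case/existsP: h => t /and3P[tX et et']; exists t.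
by case: h => t [tX et et']; apply/existsP; exists t; rewrite tX et.
Qed.

Lemma walk_adj_sym X : symmetric (@walk_adj _ X).
Proof.
move=> e e'; rewrite /walk_adj eq_sym; congr (_ && _).
by apply: eq_existsb => t; rewrite [X in _ && X]andbC.
Qed.

(** A triangle [t] containing [e] and a vertex [v] of [e] give the neighbour [t :\ v]. Conversely,
    [t] is the union of [e] with the neighbour, and [v] is the point of [t] that the neighbour
    misses. *)
Lemma card_walk_adj X (e : Edge X) : (forall t, t \in X -> #|t| = 3%N) ->
  #|[set e' | walk_adj e e']| = (#|[set t in X | val e \subset t]| * 2)%N.
Proof.
move=> X3; case/edges1P: (valP e) => ce _.
have <- : #|val @: [set e' | walk_adj e e']| = #|[set e' | walk_adj e e']|.
  exact/card_imset/val_inj.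
rewrite -[in RHS]ce -cardsX.
rewrite -[RHS](@card_in_imset _ _ (fun p => p.1 :\ p.2)); last first.
  move=> [t v] [t' v'] /=; rewrite !inE /= -!andbA.
  move=> /and3P[tX et ve] /and3P[tX' et' ve'] eqtv.
  have tE : t = t :\ v :|: val e.
    apply/setP=> z; rewrite !inE; case: eqVneq => [->|_] /=.
      by rewrite ve (subsetP et).
    by apply/idP/idP => [->//|/orP[//|/(subsetP et)]].
  have tE' : t' = t' :\ v' :|: val e.
    apply/setP=> z; rewrite !inE; case: eqVneq => [->|_] /=.
      by rewrite ve' (subsetP et').
    by apply/idP/idP => [->//|/orP[//|/(subsetP et')]].
  have tt' : t = t' by rewrite tE tE' eqtv.
  congr pair => //; apply/eqP/negPn/negP => vv'.
  move/setP/(_ v): eqtv; rewrite !inE eqxx vv' /= -tt'.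
  by rewrite (subsetP et).
congr #|pred_of_set _|; apply/setP => s; apply/imsetP/imsetP.
  move=> [e' /[!inE] /walk_adjP[ee' [t [tX et et']]] ->].
  case/edges1P: (valP e') => ce' _.
  have : #|t :\: val e'| == 1%N by rewrite cardsDS // X3 // ce'.
  case/cards1P => v tv; have tE' : val e' = t :\ v.
    by rewrite -tv setDDr setDv set0U; apply/esym/setIidPr.
  have vt : v \in t :\: val e' by rewrite tv inE.
  (* Otherwise [e] would lie in [t :\ v], which is [e'], and the two edges would coincide by
     cardinality. *)
  have ve : v \in val e.
    apply: contraNT ee' => ve; rewrite eqEcard ce ce' andbT.
    by rewrite tE' subsetD1 et ve.
  by exists (t, v) => //; rewrite !inE tX et ve.
move=> [[t v] /[!inE] /= /andP[/andP[tX et] ve] ->].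
have vt : v \in t := subsetP et _ ve.
have tvX : t :\ v \in edges1 X.
  apply/edges1P; split; last by exists t => //; apply: subsetDl.
  by move: (X3 _ tX); rewrite (cardsD1 v) vt => -[].
exists (mkEdge tvX) => //; rewrite inE; apply/walk_adjP; split => /=.
  by apply: contraTneq ve => ->; rewrite !inE eqxx.
by exists t; split => //; apply: subsetDl.
Qed.
End Walk.

(** * Commutative triplet structures *)

Section TripletStructure.
Variables (gT : finGroupType) (S : {set {set gT}}).
Local Open Scope group_scope.
Hypothesis S3 : forall t, t \in S -> #|t| = 3%N.
Hypothesis S_CTS : CTS S.
Let T := edges1 S.
Implicit Types (g h : gT) (x y z : gT * Edge S).

Lemma edge_pair (e : {set gT}) : e \in T -> exists a b, a != b /\ e = [set a; b].
Proof. by case/edges1P => /eqP/cards2P[a [b [ab ->]]] _; exists a, b. Qed.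

(* [hat] multiplies in the enumeration order of [gT], which commutation makes
   irrelevant. *)
Lemma hat_pair (a b g : gT) : a != b -> a * b = b * a -> hat [set a; b] g = a * b * g.
Proof.
move=> ab abC; rewrite /hat -big_filter; congr (_ * _).
have: perm_eq [seq x <- index_enum _ | x \in [set a; b]] [:: a; b].
  apply: uniq_perm; rewrite ?filter_uniq ?index_enum_uniq //= ?inE ?andbT // => z.
  by rewrite mem_filter mem_index_enum andbT !inE.
move: [seq x <- _ | _] => s ps.
case: s ps (perm_size ps) => [|u [|v []]] // ps _.
have := perm_mem ps u; have := perm_mem ps v; have := perm_uniq ps.
rewrite /= !inE !eqxx ab /= orbT !andbT => uv.
rewrite big_cons big_seq1.
case/esym/orP => /eqP vE; case/esym/orP => /eqP uE; subst => //.
all: by rewrite ?eqxx in uv.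
Qed.

Lemma inv_set_pair (a b : gT) : inv_set [set a; b] = [set a^-1; b^-1].
Proof. by rewrite /inv_set imsetU1 imset_set1. Qed.

Lemma edge_mulC (a b : gT) : [set a; b] \in T -> a * b = b * a.
Proof. by case: S_CTS => _ [_ [abC _]]; apply: abC. Qed.

Lemma edge_neqV (a b : gT) : [set a; b] \in T -> b != a^-1.
Proof.
move=> abT; apply/eqP => bE; case: S_CTS => /(_ a) + _; rewrite -bE abT.
case/edges1P: (abT) => _ [t tS abt] /(_ _)/negP; apply => //.
by apply/bigcupP; exists t => //; rewrite (subsetP abt) // !inE eqxx.
Qed.

Lemma inv_set_edge (e : {set gT}) : e \in T -> inv_set e \in T.
Proof.
move=> eT; have [a [b [_ eE]]] := edge_pair eT.
case: S_CTS => _ [_ [_ [invT _]]].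
by rewrite eE inv_set_pair -invT -eE.
Qed.

(** * The blue involution and the fibres of translation *)

Definition edge_inv (e : Edge S) : Edge S := mkEdge (inv_set_edge (valP e)).
Definition blue (x : gT * Edge S) : gT * Edge S := (hat (val x.2) x.1, edge_inv x.2).
(** The map onto the edges of [Sc S] whose fibres turn out to be the blue pairs. *)
Definition translate (x : gT * Edge S) : {set gT} := val x.2 :* x.1.

Lemma eq_state x y : x.1 = y.1 -> val x.2 = val y.2 -> x = y.
Proof. by case: x y => g e [h f] /= -> /val_inj ->. Qed.

Lemma blueP x : exists a b,
  [/\ a != b, val x.2 = [set a; b], [set a; b] \in T, a * b = b * a &
      (blue x).1 = a * b * x.1 /\ val (blue x).2 = [set a^-1; b^-1]].
Proof.
have [a [b [ab eE]]] := edge_pair (valP x.2).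
have abT : [set a; b] \in T by rewrite -eE (valP x.2).
exists a, b; split => //; first exact: edge_mulC.
by rewrite /= eE hat_pair ?inv_set_pair //; apply: edge_mulC.
Qed.

(** Commutativity gives [a^-1 * b^-1 * (a * b * g) = g]. *)
Lemma blueK : involutive blue.
Proof.
move=> x; have [a [b [ab eE abT abC [B1 B2]]]] := blueP x.
case: x => g e /= in eE B1 B2 *.
rewrite /blue /=; congr pair; last first.
  by apply: val_inj; rewrite /= [sval e]eE !inv_set_pair !invgK.
rewrite eE inv_set_pair (hat_pair _ ab abC) hat_pair; last 2 first.
- by rewrite (inj_eq invg_inj).
- by rewrite -!invMg abC.
by rewrite abC -!mulgA mulKg mulKg.
Qed.

(** A fixed first coordinate would force [a * b = 1], which condition (0) forbids. *)
Lemma blue_fst_neq x : (blue x).1 != x.1.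
Proof.
have [a [b [ab eE abT abC [-> _]]]] := blueP x.
rewrite -[X in _ != X]mul1g (inj_eq (mulIg _)) -eq_invg_mul eq_sym.
exact: edge_neqV.
Qed.

(** As [blue] is an involution, symmetrizing [blue_step] adds no edges: each state has exactly one
    blue neighbour. *)
Lemma blue_adjE x y : blue_adj x y = (y == blue x).
Proof.
have stepE z w : blue_step z w = (w == blue z).
  by rewrite /blue_step -pair_eqE /= /pair_eq /= andbC.
by rewrite /blue_adj !stepE -(inv_eq blueK) [_ == x]eq_sym eq_sym orbb.
Qed.

(** The two points are swapped: [a^-1 * (a * b * g) = b * g] and [b^-1 * (a * b * g) = a * g]. *)
Lemma translate_blue x : translate (blue x) = translate x.
Proof.
have [a [b [ab eE abT abC [B1 B2]]]] := blueP x.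
rewrite /translate B1 B2 eE -!rcosetE /rcoset !imsetU1 !imset_set1 setUC.
by rewrite -!mulgA mulKg [a * _]mulgA abC -mulgA mulKg.
Qed.

(** Matching the points of the two translates gives equal quotients [a * b^-1 = a' * b'^-1];
    condition (D) then leaves only the same ordered pair or the inverted, swapped one. *)
Lemma translate_eq x y : translate x = translate y -> y = x \/ y = blue x.
Proof.
have [a [b [ab eE abT abC [B1 B2]]]] := blueP x.
move=> exy.
have /rcosetP[a' a'y a'E] : a * x.1 \in translate y.
  by rewrite -exy /translate mem_rcoset mulgK eE !inE eqxx.
have /rcosetP[b' b'y b'E] : b * x.1 \in translate y.
  by rewrite -exy /translate mem_rcoset mulgK eE !inE eqxx orbT.
have ab' : a' != b'.
  by apply: contraNneq ab => abE; rewrite -(inj_eq (mulIg x.1)) a'E b'E abE.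
have yE : val y.2 = [set a'; b'].
  case/edges1P: (valP y.2) => cy _; apply/esym/eqP.
  rewrite eqEcard cards2 ab' [#|_|]cy andbT.
  by apply/subsetP => z; rewrite !inE => /orP[]/eqP->.
have abT' : [set a'; b'] \in T by rewrite -yE (valP y.2).
have quo : a * b^-1 = a' * b'^-1.
  have -> : a' = a * x.1 * y.1^-1 by rewrite a'E mulgK.
  have -> : b' = b * x.1 * y.1^-1 by rewrite b'E mulgK.
  by rewrite !invMg invgK -!mulgA mulKg mulKVg.
have [[aE bE]|ne] := eqVneq (a, b) (a', b').
  left; apply: eq_state; last by rewrite eE yE aE bE.
  by move: a'E; rewrite -aE => /mulgI.
case: S_CTS => _ [_ [_ [_ [D _]]]].
have [b'V a'V] := D _ _ _ _ abT abT' ne quo.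
right; apply: eq_state; last by rewrite B2 yE a'V b'V setUC.
by rewrite B1 abC -mulgA a'E a'V mulKVg.
Qed.

(** * Edges of the Cayley complex as translates *)

Lemma translate_edge x : translate x \in edges1 (Sc S).
Proof.
case/edges1P: (valP x.2) => ce [t tS et].
apply/edges1P; split; first by rewrite /translate card_rcoset.
exists (t :* x.1); last exact: mulSg.
by apply/imset2P; exists t x.1; rewrite ?inE.
Qed.

Definition Translate x : Edge (Sc S) := mkEdge (translate_edge x).

Lemma rcoset_edge (e s : {set gT}) h : #|e| = 2%N -> s \in S -> e \subset s :* h ->
  e :* h^-1 \in T.
Proof.
move=> ce sS es; apply/edges1P; split; first by rewrite card_rcoset.
by exists s => //; rewrite -(rcosetK h s) mulSg.
Qed.

Lemma Translate_surj (e : Edge (Sc S)) : exists x, e = Translate x.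
Proof.
case/edges1P: (valP e) => ce [_ /imset2P[s h sS _ ->] es].
exists (h, mkEdge (rcoset_edge ce sS es)); apply: val_inj => /=.
by rewrite /translate /= rcosetKV.
Qed.

Lemma red_adj_walk x y : red_adj x y -> walk_adj (Translate x) (Translate y).
Proof.
case/andP => /eqP xy1 /walk_adjP[xy2 [t [tS xt yt]]]; apply/walk_adjP; split.
  rewrite /= /translate -xy1; apply: contraNneq xy2 => /(congr1 (fun A => A :* x.1^-1)).
  by rewrite !rcosetK => ->.
exists (t :* x.1); split; first by apply/imset2P; exists t x.1; rewrite ?inE.
  exact: mulSg.
by rewrite /= /translate -xy1; apply: mulSg.
Qed.

(** The common triangle is some [s :* h], so both edges pull back to red-adjacent states over [h].
    The one in the fibre of [x] is [x] or [blue x]. *)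
Lemma walk_adj_Translate x (e : Edge (Sc S)) : walk_adj (Translate x) e ->
  exists y, e = Translate y /\ (red_adj x y || red_adj (blue x) y).
Proof.
case/walk_adjP => xe [_ [/imset2P[s h sS _ ->] xs es]].
case/edges1P: (valP e) => ce _; case/edges1P: (valP (Translate x)) => cx _.
pose z : gT * Edge S := (h, mkEdge (rcoset_edge cx sS xs)).
pose y : gT * Edge S := (h, mkEdge (rcoset_edge ce sS es)).
have zE : translate z = translate x by rewrite /translate /= rcosetKV.
have yE : e = Translate y by apply: val_inj; rewrite /= /translate /= rcosetKV.
exists y; split => //.
have zy : red_adj z y.
  rewrite /red_adj eqxx /=; apply/walk_adjP; split => /=.
    apply: contraNneq xe => /(congr1 (fun A => A :* h)).
    by rewrite !rcosetKV => /eqP.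
  by exists s; split => //; rewrite -(rcosetK h s) mulSg.
by case: (translate_eq (esym zE)) => <-; rewrite zy ?orbT.
Qed.

(** * Neighbours of an edge as two disjoint links *)

Lemma edges_meet (t e f : {set gT}) : #|t| = 3%N -> e \subset t -> f \subset t ->
  #|e| = 2%N -> #|f| = 2%N -> exists2 c, c \in e & c \in f.
Proof.
move=> ct et ft ce cf; apply/exists_inP; rewrite -[[exists _ in _, _]]negbK.
rewrite negb_exists_in; apply/negP => /forall_inP disj.
have: (#|e :|: f| <= 3)%N by rewrite -ct subset_leq_card // subUset et.
rewrite cardsU ce cf; suff -> : e :&: f = set0 by rewrite cards0.
by apply/setP => c; rewrite !inE; apply/andP => -[/disj/negP].
Qed.

(** Two distinct edges of a triangle are [[set c; d]] and [[set c; d']] with a common vertex [c], so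
    equal products would force [d = d']. *)
Lemma hat_walk_adj (e f : Edge S) g : walk_adj e f -> hat (val e) g != hat (val f) g.
Proof.
case/walk_adjP => ef [t [tS et ft]].
case/edges1P: (valP e) => ce _; case/edges1P: (valP f) => cf _.
have [c ce' cf'] := edges_meet (S3 tS) et ft ce cf.
(* Commutativity allows the shared vertex to be written first. *)
have through (k : Edge S) : c \in val k ->
    exists d, val k = [set c; d] /\ hat (val k) g = c * d * g.
  have [a [b [ab kE abT abC [B1 _]]]] := blueP (g, k).
  have {}kE : val k = [set a; b] := kE.
  have {}B1 : hat (val k) g = a * b * g := B1.
  rewrite B1 kE !inE => /orP[]/eqP->.
    by exists b.
  by exists a; rewrite setUC abC.
have [d [eE ->]] := through _ ce'; have [d' [fE ->]] := through _ cf'.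
apply: contraNneq ef => /mulIg/mulgI dd'.
by rewrite eE fE dd'.
Qed.

Lemma Translate_red_inj x : {in [set y | red_adj x y] &, injective Translate}.
Proof.
move=> [g e] [h f]; rewrite !inE => /andP[/= /eqP <- _] /andP[/= /eqP <- _].
move/(congr1 val) => /=; rewrite /translate /= => /(congr1 (fun A => A :* x.1^-1)).
by rewrite !rcosetK => /val_inj ->.
Qed.

(** Red steps keep the group coordinate. If [y] and [z] had the same image, [z] would be [y],
    against [blue_fst_neq], or [blue y], against [hat_walk_adj]. *)
Lemma Translate_red_disjoint x :
  [disjoint Translate @: [set y | red_adj x y] & Translate @: [set y | red_adj (blue x) y]].
Proof.
rewrite disjoints_subset; apply/subsetP => _ /imsetP[y /[!inE] xy ->].
apply/negP => /imsetP[z /[!inE] xz /(congr1 val)] /=.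
case/andP: xy => /eqP xy1 xy2; case/andP: xz => /eqP xz1 xz2.
case/translate_eq => zE; move: (blue_fst_neq x); rewrite xz1 zE.
  by rewrite xy1 eqxx.
have := hat_walk_adj x.1 xy2.
by move: xz1; rewrite zE /= -xy1 => ->; rewrite eqxx.
Qed.

Lemma walk_neighbours x :
  [set e | walk_adj (Translate x) e] =
  Translate @: [set y | red_adj x y] :|: Translate @: [set y | red_adj (blue x) y].
Proof.
apply/setP => e; rewrite !inE; apply/idP/orP.
  case/walk_adj_Translate => y [-> /orP[] xy]; [left|right]; apply/imsetP.
    by exists y; rewrite ?inE.
  by exists y; rewrite ?inE.
case=> /imsetP[y /[!inE] xy ->]; first exact: red_adj_walk.
have -> : Translate x = Translate (blue x) by apply: val_inj; rewrite /= translate_blue.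
exact: red_adj_walk.
Qed.

Lemma sum_walk_neighbours (M : nmodType) (f : Edge (Sc S) -> M) x :
  (\sum_(e in [set e | walk_adj (Translate x) e]) f e =
  \sum_(y in [set y | red_adj x y]) f (Translate y) +
  \sum_(y in [set y | red_adj (blue x) y]) f (Translate y))%R.
Proof.
rewrite walk_neighbours; under eq_bigl do rewrite inE.
rewrite bigU ?Translate_red_disjoint //=.
by rewrite !big_imset //; apply: Translate_red_inj.
Qed.

Lemma card_walk_neighbours x :
  #|[set e | walk_adj (Translate x) e]| =
  (#|[set y | red_adj x y]| + #|[set y | red_adj (blue x) y]|)%N.
Proof.
rewrite walk_neighbours cardsU -[RHS]subn0; congr (_ - _)%N.
  by rewrite !card_in_imset //; apply: Translate_red_inj.
by move: (Translate_red_disjoint x); rewrite -setI_eq0 => /eqP->; rewrite cards0.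
Qed.

Lemma red_adj_sym : symmetric (@red_adj _ S).
Proof. by move=> x y; rewrite /red_adj eq_sym walk_adj_sym. Qed.

(** The degree is twice the constant of condition (A). Without edges that constant is arbitrary, so
    positivity is asserted only when a state exists. *)
Lemma red_degree : exists2 d, (0 < #|{: gT * Edge S}| -> 0 < d)%N &
  forall x, #|[set y | red_adj x y]| = d.
Proof.
case: S_CTS => _ [[d reg] _].
have edge_deg (e : Edge S) : #|[set f | walk_adj e f]| = (d * 2)%N.
  by rewrite card_walk_adj // reg ?(valP e).
exists (d * 2)%N => [/card_gt0P[[g e] _]|[g e]].
  rewrite muln_gt0 andbT -(reg _ (valP e)); apply/card_gt0P.
  by case/edges1P: (valP e) => _ [t tS et]; exists t; rewrite inE tS.
have pair_inj : injective (fun f : Edge S => (g, f)) by move=> f f' [].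
rewrite -(edge_deg e) -[RHS](card_imset _ pair_inj).
congr #|pred_of_set _|; apply/setP => -[h f]; rewrite inE /red_adj /=.
apply/andP/imsetP => [[/eqP <- ef]|[f' /[!inE] ef [-> ->]]] //.
by exists f; rewrite ?inE.
Qed.
End TripletStructure.

(** * Lifting an eigenfunction of the walk *)

Theorem mainTheorem2 (R : realType) (gT : finGroupType) (S : {set {set gT}})
  (S_ne : S != set0) (S_dim2 : forall t, t \in S -> #|t| = 3%N)
  (S_CTS : CTS S) (l1 l2 : R)
  (Hl1 : is_lambda (Gwalk_op R (Sc S)) l1)
  (Hl2 : is_lambda (zigzag_op R S) l2) :
  l1 <= Num.sqrt (2^-1 + 2^-1 * l2).
Proof.
case: Hl1 Hl2 => -[f [[e [e' fe]] evf]] _ [_ ub].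
have [d d_gt0 deg] := red_degree S_dim2 S_CTS.
pose Phi := @Translate _ S; pose F x := f (Phi x).
(* Preimages of two edges separated by [f] witness that the lift [F] is non-constant. *)
have [x xE] := Translate_surj e; have [y yE] := Translate_surj e'.
have {}d_gt0 : (0 < d)%N by apply: d_gt0; apply/card_gt0P; exists x.
have blue_kernel z w : nadj R (@blue_adj _ S) z w = (w == blue S_CTS z)%:R.
  rewrite /nadj blue_adjE.
  have -> : [set v | blue_adj z v] = [set blue S_CTS z].
    by apply/setP => v; rewrite !inE blue_adjE.
  by rewrite cards1 divr1.
(* The neighbours of [Phi z] split into two links of size [d], so averaging over [2d] neighbours is
   the mean of two red averages. *)
have evF z : l1 * F z =
    2^-1 * (\sum_w nadj R (@red_adj _ S) z w * F w +
            \sum_w nadj R (@red_adj _ S) (blue S_CTS z) w * F w).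
  rewrite -evf /Gwalk_op !nadj_apply !deg (sum_walk_neighbours S_dim2 S_CTS).
  rewrite (card_walk_neighbours S_dim2 S_CTS) !deg addnn -muln2 natrM invfM.
  by rewrite -mulrDr mulrA [_^-1 * 2^-1]mulrC.
have l1_sqr : l1 ^+ 2 <= 2^-1 + 2^-1 * l2.
  apply: (folded_eigenvalue_sqr_le _ _ _ (blueK S_CTS) blue_kernel ub _ evF).
  - exact: (nadj_sym R (@red_adj_sym _ S) deg).
  - exact: nadj_ge0.
  - by move=> z; apply: nadj_sum1; rewrite deg.
  - by exists x, y; rewrite /F /Phi -xE -yE.
(* [l1] is at most its absolute value, which is the square root of its square. *)
by rewrite (le_trans (ler_norm _)) // -sqrtr_sqr ler_wsqrtr.
Qed.
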